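(* Let $k$ be a field of characteristic $p$, $G$ a finite group, and $\Delta$ a weak synthetic building for $G$ at $p$. For each simple $kG$-module $S$, the multiplicity of $P_S$ in $\tilde L(\Delta)$ is $0$ unless $\dim_k S\ge\min_{\sigma\in\Delta}|G_\sigma|_p$. Thus if $\Delta$ is a synthetic building and $p$ divides $|G|$ then $P_k$ does not appear as a summand of $\tilde L(\Delta)$.
   Context: A $G$-simplicial complex is a finite simplicial complex $\Delta$ with a simplicial action of the finite group $G$ such that the setwise stabilizer of each simplex fixes that simplex pointwise. For $H\le G$, $\Delta^H$ denotes the fixed point subcomplex. A $G$-simplicial complex $\Delta$ is a weak synthetic building for $G$ at the prime $p$ if (1) $\Delta^P$ is $N_G(P)$-equivariantly contractible for every non-identity $p$-subgroup $P\le G$; it is a synthetic building if in addition (2) the stabilizer $G_\sigma$ of every simplex $\sigma$ has order divisible by $p$. $|H|_p$ is the order of a Sylow $p$-subgroup of $H$. $P_S$ is the projective cover of the simple $kG$-module $S$, and $P_k$ that of the trivial module. $\tilde C_\cdot(\Delta)$ is the augmented simplicial chain complex over $k$ (with $\tilde C_{-1}=k$). The reduced Lefschetz module is $\tilde L(\Delta)=\sum_{i\ge -1}(-1)^i\tilde C_i(\Delta)$ in the Green ring of finitely generated $kG$-modules (the free abelian group on isomorphism classes of indecomposable modules). It is a known theorem that for a weak synthetic building $\tilde L(\Delta)$ is a virtual projective module, i.e. $\tilde L(\Delta)=\sum_S n_S P_S$ with $n_S\in\mathbb Z$, the sum being over simple $kG$-modules $S$; the multiplicity of $P_S$ in $\tilde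 L(\Delta)$ means $n_S$, and $P_S$ does not appear as a summand when $n_S=0$. *)

(* Defs.v *)
From HB Require Import structures.
From mathcomp Require Import all_classical all_reals topology.
From mathcomp Require Import all_boot all_order all_algebra all_fingroup.
From mathcomp Require Import pgroup mxrepresentation character freeg.

Set Implicit Arguments.
Unset Strict Implicit.
Unset Printing Implicit Defensive.

Import Order.TTheory GRing.Theory Num.Theory numFieldTopology.Exports.
Local Open Scope ring_scope.

(* Conventions.  Finitely generated kG-modules are matrix representations of  *)
(* G over k acting on row vectors, so modules are right modules, and groups   *)
(* act on complexes on the right.  Subspaces are row spaces.                  *)

(* ------------------------------------------------------------------------- *)
Section Modules.

Variables (k : fieldType) (gT : finGroupType) (G : {group gT}).
Implicit Types M N P S : representation k G.

Definition kG_hom M N (f : 'M[k]_(rdegree M, rdegree N)) : Prop :=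
  forall g, g \in G -> M g *m f = f *m N g.

(* P is finitely generated, so it is enough to lift along surjections between *)
(* finitely generated modules.                                                *)
Definition projective P : Prop :=
  forall M N (q : 'M[k]_(rdegree M, rdegree N))
         (h : 'M[k]_(rdegree P, rdegree N)),
    kG_hom q -> row_full q -> kG_hom h ->
  exists2 l : 'M[k]_(rdegree P, rdegree M), kG_hom l & l *m q = h.

Definition essential_epi M N (q : 'M[k]_(rdegree M, rdegree N)) : Prop :=
  [/\ kG_hom q, row_full q
    & forall U : 'M[k]_(rdegree M), mxmodule M U ->
        row_full (U *m q) -> row_full U].

Definition projective_cover P S : Prop :=
  projective P /\
  exists q : 'M[k]_(rdegree P, rdegree S), essential_epi q.

Definition indecomposable M : Prop :=
  (0 < rdegree M)%N /\
  forall U V : 'M[k]_(rdegree M), mxmodule M U -> mxmodule M V ->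
    (U + V :=: 1%:M)%MS -> mxdirect (U + V) -> U = 0 \/ V = 0.

Lemma projective_cover_indecomposable P S :
  mx_irreducible S -> projective_cover P S -> indecomposable P.
Proof.
move=> /mx_irrP[S_gt0 simS] [_ [q [homq fullq essq]]]; split.
  case: (posnP (rdegree P)) => // P0; move: fullq; rewrite /row_full.
  have := rank_leq_row q; rewrite {2}P0 leqn0 => /eqP-> /eqP S0.
  by rewrite -S0 in S_gt0.
move=> U V modU modV defUV dxUV.
have modI (W : 'M_(rdegree P)) : mxmodule P W -> mxmodule S <<W *m q>>%MS.
  move=> modW; rewrite (eqmx_module _ (genmxE _)).
  apply/mxmoduleP=> g Gg; rewrite -mulmxA -homq // mulmxA submxMr //.
  exact: (mxmoduleP modW).
have full (W W' : 'M_(rdegree P)) : mxmodule P W -> W *m q != 0 ->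
    mxdirect (W + W') -> W' = 0.
  move=> modW nzW /mxdirect_addsP dx.
  have: row_full W.
    apply: essq => //; have := simS _ (modI _ modW).
    rewrite -!mxrank_eq0 genmxE mxrank_eq0 /row_full genmxE.
    exact.
  rewrite -sub1mx => W1; apply/eqP; rewrite -submx0 -dx sub_capmx submx_refl.
  by rewrite andbT (submx_trans (submx1 _)).
case: (eqVneq (U *m q) 0) => [Uq0|nzU]; last by right; apply: full nzU dxUV.
case: (eqVneq (V *m q) 0) => [Vq0|nzV]; last first.
  left; apply: full nzV _ => //; apply/mxdirect_addsP.
  by rewrite capmxC; apply/mxdirect_addsP.
have: ((1%:M : 'M_(rdegree P)) <= U + V)%MS by rewrite defUV.
case/sub_addsmxP=> c def1; have q0 : q = 0.
  by rewrite -[q]mul1mx def1 mulmxDl -!mulmxA Uq0 Vq0 !mulmx0 addr0.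
by move: fullq; rewrite /row_full q0 mxrank0 => /eqP S0; rewrite -S0 in S_gt0.
Qed.

(* ------------------------------------------------------------------------- *)
(* The Green ring: the free abelian group on the isomorphism classes of       *)
(* indecomposable modules (only its additive structure is needed).            *)

Record indec_repr := IndecRepr {
  indec_val :> representation k G;
  indecP : indecomposable indec_val }.

HB.instance Definition _ := gen_eqMixin indec_repr.
HB.instance Definition _ := gen_choiceMixin indec_repr.

Definition indec_iso (X Y : indec_repr) : bool := `[< mx_rsim X Y >].

Lemma indec_iso_refl : reflexive indec_iso.
Proof. by move=> X; apply/asboolP; apply: mx_rsim_refl. Qed.

Lemma indec_iso_sym : symmetric indec_iso.
Proof.
by move=> X Y; apply/asboolP/asboolP => /mx_rsim_sym.
Qed.

Lemma indec_iso_trans : transitive indec_iso.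
Proof.
move=> Y X Z /asboolP XY /asboolP YZ; apply/asboolP.
exact: mx_rsim_trans XY YZ.
Qed.

Canonical indec_iso_equiv :=
  EquivRel indec_iso indec_iso_refl indec_iso_sym indec_iso_trans.

Definition indec_class := {eq_quot indec_iso_equiv}%qT.

Definition iso_class (X : indec_repr) : indec_class :=
  (\pi_indec_class X)%qT.

Definition green_ring := {freeg indec_class / int}.

Definition dsum (s : seq indec_repr) : representation k G :=
  \big[@dadd_grepr k gT G/grepr0]_(X <- s) (X : representation k G).

Lemma rsim_dadd M M' N N' :
  mx_rsim M M' -> mx_rsim N N' -> mx_rsim (dadd_grepr M N) (dadd_grepr M' N').
Proof.
move=> [A eA fA hA] [B eB fB hB]; exists (block_mx A 0 0 B) => /=.
- by rewrite eA eB.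
- have /row_freeP[A' AA'] := fA; have /row_freeP[B' BB'] := fB.
  apply/row_freeP; exists (block_mx A' 0 0 B').
  by rewrite mulmx_block !(mulmx0, mul0mx, addr0, add0r) AA' BB'
             -scalar_mx_block.
move=> g Gg; rewrite !mulmx_block !(mulmx0, mul0mx, addr0, add0r).
by rewrite hA ?hB.
Qed.

Lemma rsim_dadd0 M : mx_rsim (dadd_grepr M grepr0) M.
Proof.
exists (col_mx 1%:M 0) => /=; first by rewrite addn0.
- apply/row_freeP; exists (row_mx 1%:M 0).
  rewrite mul_col_row !(mulmx0, mul0mx, mulmx1) scalar_mx_block.
  by congr block_mx; apply/matrixP=> i j; first [by case: i | by case: j].
move=> g Gg; rewrite mul_block_col mul_col_mx.
by rewrite !(mulmx0, mul0mx, mulmx1, mul1mx, addr0).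
Qed.

Lemma rsim_cast n1 n2 (e : n1 = n2) (r1 : mx_representation k G n1)
    (r2 : mx_representation k G n2) :
  {in G, forall g, r2 g = castmx (e, e) (r1 g)} -> mx_rsim r1 r2.
Proof.
case: n2 / e r2 => r2 er; exists 1%:M => // [|g Gg].
  by rewrite /row_free mxrank1.
by rewrite mulmx1 mul1mx er // castmx_id.
Qed.

Lemma rsim_daddA (A B C : representation k G) :
  mx_rsim (dadd_grepr (dadd_grepr A B) C) (dadd_grepr A (dadd_grepr B C)).
Proof.
apply: (rsim_cast (e := esym (addnA _ _ _))) => g Gg /=.
have := @block_mxA k _ _ _ _ _ _ (A g) 0 0 0 (B g) 0 0 0 (C g).
by rewrite /= !row_mx0 !col_mx0.
Qed.

Lemma rsim_split M (U V : 'M[k]_(rdegree M))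
    (modU : mxmodule M U) (modV : mxmodule M V) :
  (U + V :=: 1%:M)%MS -> mxdirect (U + V) ->
  mx_rsim M (dadd_grepr (Representation (submod_repr modU))
                        (Representation (submod_repr modV))).
Proof.
move=> defUV dxUV.
have simM := rsim_submod1 (mxmodule1 M) (eqmx_refl _).
apply: mx_rsim_trans (mx_rsim_sym simM) _.
exact: (@mx_rsim_dadd k gT G _ M U V 1%:M
  (Representation (submod_repr modU)) (Representation (submod_repr modV))
  modU modV (mxmodule1 M) defUV dxUV (mx_rsim_refl _) (mx_rsim_refl _)).
Qed.

Lemma dsum_cat s t : mx_rsim (dsum (s ++ t)) (dadd_grepr (dsum s) (dsum t)).
Proof.
elim: s => [|X s IHs] /=.
  rewrite [dsum [::]]big_nil; apply: mx_rsim_sym.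
  apply: (rsim_cast (e := add0n _)) => g Gg /=.
  by rewrite castmx_id /block_mx col_flat_mx row_thin_mx.
rewrite [dsum (X :: _)]big_cons [dsum (X :: s)]big_cons -!/(dsum _).
apply: mx_rsim_trans (rsim_dadd (mx_rsim_refl X) IHs) _.
exact: mx_rsim_sym (rsim_daddA _ _ _).
Qed.

Lemma krull_schmidt_exists M : exists s : seq indec_repr, mx_rsim M (dsum s).
Proof.
have [n] := ubnP (rdegree M); elim: n M => // n IHn M; rewrite ltnS => leMn.
have [M0|M_gt0] := posnP (rdegree M).
  exists [::]; rewrite /dsum big_nil; exists 0 => //=.
    by rewrite /row_free mxrank0 M0.
  by move=> g _; rewrite mulmx0 mul0mx.
have [indM|dM] := pselect (indecomposable M).
  exists [:: IndecRepr indM]; rewrite /dsum big_cons big_nil.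
  exact: mx_rsim_sym (rsim_dadd0 _).
have [U [V [modU modV defUV [dxUV nzU nzV]]]] :
    exists U V : 'M[k]_(rdegree M), [/\ mxmodule M U, mxmodule M V,
      (U + V :=: 1%:M)%MS & [/\ mxdirect (U + V), U != 0 & V != 0]].
  apply: contrapT => nex; apply: dM; split=> // U V mU mV e dx.
  case: (eqVneq U 0) => [|nU]; first by left.
  case: (eqVneq V 0) => [|nV]; first by right.
  by case: nex; exists U, V.
have rk : (\rank U + \rank V = rdegree M)%N.
  by rewrite -(mxdirectP dxUV) /= defUV mxrank1.
have U_gt0 : (0 < \rank U)%N by rewrite lt0n mxrank_eq0.
have V_gt0 : (0 < \rank V)%N by rewrite lt0n mxrank_eq0.
have [|s Us] := IHn (Representation (submod_repr modU)).
  rewrite /=; apply: leq_trans leMn.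
  by rewrite -[X in (_ < X)%N]rk -addn1 leq_add2l.
have [|t Vt] := IHn (Representation (submod_repr modV)).
  rewrite /=; apply: leq_trans leMn.
  by rewrite -[X in (_ < X)%N]rk -add1n leq_add2r.
exists (s ++ t); apply: mx_rsim_trans (mx_rsim_sym (dsum_cat _ _)).
apply: mx_rsim_trans (rsim_dadd Us Vt).
exact: rsim_split.
Qed.

(* By the Krull-Schmidt theorem the class below does not depend on the chosen *)
(* decomposition.                                                             *)
Definition indec_summands M : seq indec_repr :=
  projT1 (cid (krull_schmidt_exists M)).

Definition green_class M : green_ring :=
  \sum_(X <- indec_summands M) << iso_class X >>.

Definition pim_mult P S (simS : mx_irreducible S)
    (covP : projective_cover P S) (L : green_ring) : int :=
  coeff (iso_class (IndecRepr (projective_cover_indecomposable simS covP))) L.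

Lemma trivial_mx_repr : mx_repr G (fun _ : gT => 1%:M : 'M[k]_1).
Proof. by split=> // g h _ _; rewrite mulmx1. Qed.

Definition trivial_repr : representation k G :=
  Representation (MxRepresentation trivial_mx_repr).

Lemma trivial_irreducible : mx_irreducible trivial_repr.
Proof. by apply/mx_abs_irrW/linear_mx_abs_irr. Qed.

End Modules.

(* ------------------------------------------------------------------------- *)
Section Complexes.

Variables (gT : finGroupType) (G : {group gT}) (V : finType).

(* Simplices are nonempty; elements of V need not be vertices of the complex. *)
Record G_complex := GComplex {
  cact :> action G V;
  simplices : {set {set V}};
  simplices_neq0 : set0 \notin simplices;
  simplices_down : forall s t : {set V},
    s \in simplices -> t \subset s -> t != set0 -> t \in simplices;
  simplices_act : [acts G, on simplices | cact^*];
  simplices_stab : forall s, s \in simplices ->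
    'N_G(s | cact)%g \subset 'C_G(s | cact)%g }.

Definition fixed_complex (D : G_complex) (P : {set gT}) : {set {set V}} :=
  [set s in simplices D | P \subset 'C_G(s | D)%g]%SET.

Section Realization.

Variable R : realType.

(* For a finite complex this subspace of R^V carries the weak topology. *)
Definition realization (K : {set {set V}}) : set {ptws V -> R} :=
  [set x | [/\ forall v, 0 <= x v, \sum_v x v = 1
             & [set v | x v != 0]%SET \in K]]%classic.

(* The affine extension of the action on vertices: v has the same weight in x *)
(* as its image under g has in real_act D x g.                                    *)
Definition real_act (D : G_complex) (x : {ptws V -> R}) (g : gT) : {ptws V -> R} :=
  fun v => x (D v (g^-1)%g).

Definition equivariantly_contractible (D : G_complex) (N : {group gT})
    (K : {set {set V}}) : Prop :=
  exists (x0 : {ptws V -> R}) (H : R * {ptws V -> R} -> {ptws V -> R}),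
    [/\ realization K x0 /\ (forall g, g \in N -> real_act D x0 g = x0),
        {within `[0, 1] `*` realization K, continuous H}%classic,
        forall t x, 0 <= t <= 1 -> realization K x -> realization K (H (t, x)),
        forall t x g, 0 <= t <= 1 -> realization K x -> g \in N ->
          H (t, real_act D x g) = real_act D (H (t, x)) g
      & forall x, realization K x -> H (0, x) = x /\ H (1, x) = x0].

Definition weak_synthetic_building (p : nat) (D : G_complex) : Prop :=
  forall P : {group gT}, P \subset G -> (p.-group P)%g -> P :!=: 1%g ->
    equivariantly_contractible D 'N_G(P)%G (fixed_complex D P).

Definition synthetic_building (p : nat) (D : G_complex) : Prop :=
  weak_synthetic_building p D /\
  (forall s, s \in simplices D -> (p %| #|'N_G(s | D)%g|)%N).

End Realization.

(* The default #|G|_p is an upper bound for all the terms, so it affects the  *)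
(* minimum only when D is empty.                                              *)
Definition min_stab_p (p : nat) (D : G_complex) : nat :=
  \big[minn/partn #|G| p]_(s in simplices D) partn #|'N_G(s | D)%g| p.

(* ------------------------------------------------------------------------- *)
(* The augmented chain module in dimension n - 1: the free module on the      *)
(* ordered simplices with n vertices, modulo                                  *)
(*   (v_s(0), ..., v_s(n-1)) = sgn(s) (v_0, ..., v_(n-1)).                    *)
(* The empty tuple, for n = 0, is the (-1)-simplex of the augmentation.       *)
Section Chains.

Variables (k : fieldType) (D : G_complex) (n : nat).

Definition is_osimplex (t : n.-tuple V) : bool :=
  uniq t && ([set x in t]%SET \in set0 |: simplices D).

Definition osimplex := {t : n.-tuple V | is_osimplex t}.

Definition omove (t : n.-tuple V) (g : gT) : n.-tuple V :=
  [tuple D (tnth t i) g | i < n].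

Definition operm (t : n.-tuple V) (s : 'S_n) : n.-tuple V :=
  [tuple tnth t (s i) | i < n].

Definition ochain_mx (g : gT) : 'M[k]_#|{: osimplex}| :=
  \matrix_(i, j) (val (enum_val j) == omove (val (enum_val i)) g)%:R.

Definition ovec (t : osimplex) : 'rV[k]_#|{: osimplex}| :=
  delta_mx 0 (enum_rank t).

Definition orient_mx : 'M[k]_#|{: osimplex}| :=
  (\sum_(t : osimplex) \sum_(u : osimplex)
     \sum_(s : 'S_n | val u == operm (val t) s)
       <<ovec u - (-1) ^+ s *: ovec t>>)%MS.

Lemma omove_osimplex t g : g \in G -> is_osimplex t -> is_osimplex (omove t g).
Proof.
move=> Gg /andP[ut Dt].
have -> : omove t g = map_tuple (D^~ g) t.
  by apply: eq_from_tnth => i; rewrite tnth_mktuple tnth_map.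
apply/andP; split; first by rewrite map_inj_uniq //; apply: act_inj.
have -> : [set x in map_tuple (D^~ g) t]%SET = (D^*)%act [set x in t]%SET g.
  apply/setP=> x; rewrite inE; apply/mapP/imsetP.
    by case=> y ty ->; exists y; rewrite ?inE.
  by case=> y; rewrite inE => ty ->; exists y.
move: Dt; rewrite !inE => /orP[/eqP->|Dt].
  by rewrite /= /setact imset0 eqxx.
by rewrite (acts_act (simplices_act D) Gg) Dt orbT.
Qed.

Definition osimplex_act (t : osimplex) (g : gT) (Gg : g \in G) : osimplex :=
  exist _ (omove (val t) g) (omove_osimplex Gg (valP t)).

Lemma ovec_act t g (Gg : g \in G) :
  ovec t *m ochain_mx g = ovec (osimplex_act t Gg).
Proof.
rewrite -rowE; apply/rowP=> j; rewrite !mxE eqxx /= enum_rankK.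
congr (_%:R); rewrite -(inj_eq enum_val_inj) enum_rankK.
by rewrite -val_eqE.
Qed.

Lemma ochain_mx_repr : mx_repr G ochain_mx.
Proof.
have ext (A B : 'M[k]_#|{: osimplex}|) :
    (forall t, ovec t *m A = ovec t *m B) -> A = B.
  move=> eAB; apply/row_matrixP=> i; have := eAB (enum_val i).
  by rewrite /ovec enum_valK -!rowE.
split=> [|g h Gg Gh]; apply: ext => t.
  rewrite (ovec_act _ (group1 G)) mulmx1; congr ovec; apply: val_inj => /=.
  by apply: eq_from_tnth => i; rewrite tnth_mktuple act1.
rewrite mulmxA (ovec_act t Gg) (ovec_act _ Gh) (ovec_act t (groupM Gg Gh)).
congr ovec; apply: val_inj; apply: eq_from_tnth => i /=.
by rewrite !tnth_mktuple actMin.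
Qed.

Definition ochain_repr := MxRepresentation ochain_mx_repr.

Lemma orient_module : mxmodule ochain_repr orient_mx.
Proof.
apply/mxmoduleP=> g Gg; rewrite /orient_mx.
rewrite sumsmxMr; apply/sumsmx_subP=> t _.
rewrite sumsmxMr; apply/sumsmx_subP=> u _.
rewrite sumsmxMr; apply/sumsmx_subP=> s /eqP defu.
rewrite (eqmxMr _ (genmxE _)) mulmxBl -scalemxAl /= !(ovec_act _ Gg).
apply: (sumsmx_sup (osimplex_act t Gg)) => //.
apply: (sumsmx_sup (osimplex_act u Gg)) => //.
apply: (sumsmx_sup s); last by rewrite genmxE.
by apply/eqP/eq_from_tnth=> i; rewrite /= !tnth_mktuple defu tnth_mktuple.
Qed.

Definition chain_module : representation k G :=
  Representation (factmod_repr orient_module).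

End Chains.

(* The sum over dimensions i = n - 1 >= -1; chain modules of dimension at     *)
(* least #|V| vanish.                                                         *)
Definition lefschetz_module (k : fieldType) (D : G_complex) : green_ring k G :=
  \sum_(n < #|V|.+1) (-1) ^+ n.+1 *: green_class (chain_module k D n).

End Complexes.

(* Main.v *)
(* The stabilizer H of a simplex fixes it pointwise, and ordered simplices span
   the chain modules. If P_S occurs in C_n, a surjection C_n -> P_S followed by
   P_S -> S is nonzero on some ordered simplex, whose image in P_S is fixed by H,
   hence a norm from 1 to H because P_S is projective. So the norm of H is
   nonzero on S, and so is that of a Sylow p-subgroup Q of H; then kQ embeds in
   S and dim S >= |H|_p. Thus P_S with dim S below the minimum of the
   |G_sigma|_p is already absent from every C_n, that is, before any
   cancellation in the Lefschetz module. *)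
Require Import Defs.
From mathcomp Require Import all_classical all_reals topology.
From mathcomp Require Import all_boot all_order all_algebra all_fingroup.
From mathcomp Require Import mxrepresentation character freeg.
From mathcomp Require Import pgroup sylow mxabelem.

Set Implicit Arguments.
Unset Strict Implicit.
Unset Printing Implicit Defensive.

Import GRing.Theory.
Local Open Scope ring_scope.

(** * Sums over left cosets *)

Lemma repr_lcosets_mem (gT : finGroupType) (G H : {group gT}) A :
  H \subset G -> A \in lcosets H G -> repr A \in G.
Proof.
move=> sHG /imsetP[x Gx ->] /=.
have: repr (lcoset H x) \in (x *: H)%g.
  by rewrite lcosetE; apply: mem_repr (lcoset_refl H x).
by case/lcosetP=> h Hh ->; rewrite groupM // (subsetP sHG).
Qed.

(** Left cosets put [h] last in each product, so in a right module the sum over [H] becomes the norm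
    of [H] applied to a sum over representatives. *)
Lemma sum_lcosets (U : zmodType) (gT : finGroupType) (G H : {group gT})
    (F : gT -> U) :
  H \subset G ->
  \sum_(g in G) F g = \sum_(A in lcosets H G) \sum_(h in H) F (repr A * h)%g.
Proof.
move=> sHG; rewrite (partition_big_imset (lcoset H)).
apply: eq_bigr => _ /imsetP[x Gx ->]; rewrite lcosetE; set r := repr _.
have xHr : (x *: H = r *: H)%g.
  by apply: lcoset_eqP; rewrite lcoset_sym; apply/mem_repr/lcoset_refl.
have Gr : r \in G.
  by apply: (repr_lcosets_mem sHG); rewrite -lcosetE; apply: imset_f.
rewrite (reindex_inj (mulgI r)); apply: eq_bigl => h.
rewrite /= eq_sym xHr groupMl //; apply/andP/idP=> [[_ /eqP]|Hh].
  rewrite lcosetE => eqr; have := lcoset_refl H (r * h)%g.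
  by rewrite -eqr mem_lcoset mulKg.
by rewrite (subsetP sHG) //= lcosetE lcosetM lcoset_id.
Qed.

(** * Norms, projective modules and coefficients in the Green ring *)

Section Representations.

Variables (k : fieldType) (gT : finGroupType) (G : {group gT}).
Implicit Types M N P S : representation k G.

(* Otherwise the annihilator of [w] in [kQ] is a nonzero submodule; as [Q] is a
   [p]-group it contains a nonzero fixed vector of [kQ], that is, a nonzero
   multiple of the norm element. *)
Lemma pgroup_norm_neq0_card p n (rG : mx_representation k G n)
    (Q : {group gT}) (w : 'rV[k]_n) :
  p \in [pchar k] -> (p.-group Q)%g -> Q \subset G ->
  \sum_(x in Q) w *m rG x != 0 -> (#|Q| <= n)%N.
Proof.
move=> charkp pQ sQG; apply: contraNleq => ltnQ.
(* The matrix of the map from [kQ] to [k^n] sending [a] to [w a]; its kernel, the annihilator of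
   [w], is nonzero because [n < #|Q|]. *)
pose F := \matrix_(i < #|Q|) (w *m rG (enum_val i)).
have rowF x : x \in Q -> delta_mx 0 (gring_index Q x) *m F = w *m rG x.
  by move=> Qx; rewrite -rowE rowK gring_indexK.
have rowFi i : row i F = w *m rG (enum_val i) by rewrite rowK.
have modK : mxmodule (regular_repr k Q) (kermx F).
  apply/mxmoduleP=> x Qx; apply/sub_kermxP; rewrite -mulmxA.
  have ->: regular_mx k Q x *m F = F *m rG x.
    apply/row_matrixP=> i; rewrite !row_mul rowK rowFi.
    rewrite rowF ?groupM ?enum_valP //.
    by rewrite repr_mxM ?mulmxA // (subsetP sQG) // enum_valP.
  by rewrite mulmxA mulmx_ker mul0mx.
have K_gt0 : (0 < \rank (kermx F))%N.
  rewrite mxrank_ker subn_gt0; exact: leq_ltn_trans (rank_leq_col F) ltnQ.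
have := rfix_pgroup_pchar charkp (submod_repr modK) K_gt0 pQ (subxx Q).
rewrite -mxrank_eq0 (rfix_submod modK (subxx Q)) => nzI.
have /rowV0Pn[v] : (kermx F :&: rfix_mx (regular_repr k Q) Q)%MS != 0.
  by apply: contraNneq nzI => ->; rewrite linear0 mxrank0.
rewrite sub_capmx rfix_regular => /andP[/sub_kermxP vF /sub_rVP[c def_v]] nz_v.
have nz_c : c != 0 by apply: contraNneq nz_v => c0; rewrite def_v c0 scale0r.
move/eqP: vF; rewrite def_v -scalemxAl scaler_eq0 (negPf nz_c) /=.
rewrite /gset_mx linear_sum mulmx_suml.
rewrite (eq_bigr (fun x => w *m rG x)) // => x Qx.
rewrite -rowF //; congr (_ *m _).
by rewrite /gring_row [LHS]rowK gring_indexK ?mul1g.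
Qed.

(** For a Sylow [p]-subgroup [Q] of [H], the norm of [w] over [H] is the norm over [Q] of the sum of
    the translates of [w] by representatives of the left cosets of [Q]. *)
Lemma norm_neq0_partn_leq p n (rG : mx_representation k G n)
    (H : {group gT}) (w : 'rV[k]_n) :
  p \in [pchar k] -> H \subset G ->
  \sum_(x in H) w *m rG x != 0 -> (partn #|H| p <= n)%N.
Proof.
move=> charkp sHG nz; have [Q sylQ] := Sylow_exists p H.
have sQH := pHall_sub sylQ; have sQG := subset_trans sQH sHG.
rewrite -(card_Hall sylQ).
pose v := \sum_(A in lcosets Q H) w *m rG (repr A).
apply: (pgroup_norm_neq0_card (rG := rG) (w := v) charkp _ sQG).
  exact: pHall_pgroup sylQ.
apply: contraNneq nz => nv0; apply/eqP; rewrite -[RHS]nv0.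
rewrite (sum_lcosets _ sQH) exchange_big; apply: eq_bigr => x Qx.
rewrite mulmx_suml; apply: eq_bigr => A HA.
rewrite repr_mxM ?mulmxA //; last exact: subsetP sQG x Qx.
exact: subsetP sHG _ (repr_lcosets_mem sQH HA).
Qed.

(* One direction of Higman's criterion; [theta] is the coefficient at 1 of a
   section of the free cover of [P]. *)
Lemma projective_higman P :
  projective P ->
  exists theta : 'M[k]_(rdegree P),
    \sum_(g in G) P g^-1%g *m theta *m P g = 1%:M.
Proof.
move=> projP; pose d := rdegree P.
(* [F] is the free module of rank [d], seen as functions from [G] to [k^d] (the rows of a matrix),
   with [(f g)(h) = f(h g^-1)]. The map [q] sends [f] to the sum of the [f(g) g]. *)
pose act g := lin_mx (mulmx (regular_mx k G g^-1%g) : 'M_(gcard G, d) -> _).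
have act_repr : mx_repr G act.
  split=> [|g h Gg Gh]; apply/row_matrixP=> i;
    rewrite !rowE -[delta_mx _ _]vec_mxK.
    rewrite mul_vec_lin /= invg1 mulmx1.
    by rewrite (repr_mx1 (regular_repr k G)) mul1mx.
  rewrite mulmxA !mul_vec_lin /= invMg mulmxA.
  by rewrite (repr_mxM (regular_repr k G)) ?groupV.
pose F := Representation (MxRepresentation act_repr).
pose ev g : 'M[k]_(rdegree F, d) :=
  lin1_mx (row (gring_index G g) \o (vec_mx : _ -> 'M_(gcard G, d))).
have evE (A : 'M_(gcard G, d)) g : mxvec A *m ev g = row (gring_index G g) A.
  by rewrite mul_rV_lin1 /= mxvecK.
pose q : 'M[k]_(rdegree F, rdegree P) := \sum_(g in G) ev g *m P g.
have mxvec_eq m (X Y : 'M[k]_(rdegree F, m)) :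
    (forall A, mxvec A *m X = mxvec A *m Y) -> X = Y.
  by move=> eXY; apply/row_matrixP=> i; rewrite !rowE -[delta_mx _ _]vec_mxK.
have act_ev g h : g \in G -> h \in G -> F g *m ev h = ev (h * g^-1)%g.
  move=> Gg Gh; apply: mxvec_eq => A.
  rewrite mulmxA /F /= mul_vec_lin !evE row_mul rowK gring_indexK //.
  by rewrite -rowE.
have homq : kG_hom q.
  move=> g Gg; rewrite mulmx_sumr mulmx_suml.
  rewrite (reindex_acts 'R _ Gg) ?astabsR //=; apply: eq_bigr => h Gh.
  by rewrite mulmxA act_ev ?groupM // mulgK repr_mxM // mulmxA.
have fullq : row_full q.
  (* A right inverse on vectors: [v] goes to the function supported at 1 with value [v]. *)
  apply/row_fullP; pose e1 : 'cV[k]_(gcard G) := delta_mx (gring_index G 1%g) 0.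
  exists (lin1_mx (mxvec \o mulmx e1)).
  apply/row_matrixP=> i; rewrite !rowE mulmxA mul_rV_lin1 /= /e1 mulmx_sumr.
  rewrite (bigD1 1%g) //= mulmxA evE repr_mx1 mulmx1.
  rewrite big1 ?addr0 => [|g /andP[Gg ng1]].
    by rewrite row_mul rowE !mul_delta_mx mulmx1.
  rewrite mulmxA evE row_mul rowE mul_delta_mx_0 ?mul0mx //.
  apply: contra ng1 => /eqP eq1; apply/eqP.
  by apply: (can_in_inj (@gring_indexK gT G)) eq1; rewrite ?group1.
have hom1 : kG_hom (M := P) (N := P) 1%:M by move=> g _; rewrite mulmx1 mul1mx.
have [l homl lq] := projP F P q 1%:M homq fullq hom1.
(* Since [l] is equivariant, [P g^-1 *m l *m ev 1] is [l *m ev g], so the sum is [l *m q]. *)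
exists (l *m ev 1%g); rewrite -lq mulmx_sumr; apply: eq_bigr => g Gg.
rewrite !mulmxA homl ?groupV //; congr (_ *m _).
by rewrite -mulmxA act_ev ?groupV // mul1g invgK.
Qed.

(** Apply Higman's identity to [u] and write [g = r h]: the leading [h^-1] is absorbed by the fixed
    vector [u], and the trailing [h] gives the norm of [H]. *)
Lemma projective_fixed_norm P (H : {group gT}) (u : 'rV[k]_(rdegree P)) :
  projective P -> H \subset G -> (forall h, h \in H -> u *m P h = u) ->
  exists y, u = \sum_(h in H) y *m P h.
Proof.
move=> /projective_higman[theta def1] sHG fixu.
exists (\sum_(A in lcosets H G) u *m P (repr A)^-1%g *m theta *m P (repr A)).
rewrite -[LHS]mulmx1 -def1 (sum_lcosets _ sHG) exchange_big mulmx_sumr.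
apply: eq_bigr => h Hh; have Gh := subsetP sHG h Hh.
rewrite mulmx_sumr mulmx_suml; apply: eq_bigr => A GA.
have Gr := repr_lcosets_mem sHG GA.
by rewrite invMg !repr_mxM ?groupV // !mulmxA fixu ?groupV.
Qed.

Lemma rsim_surjection M N :
  mx_rsim M N -> exists2 f : 'M_(rdegree M, rdegree N), kG_hom f & row_full f.
Proof.
case=> f eMN freef homf; exists f => //.
by rewrite /row_full (eqP freef) eMN.
Qed.

Lemma dsum_surjection s (X : indec_repr k G) :
  X \in s ->
  exists2 f : 'M_(rdegree (dsum s), rdegree X), kG_hom f & row_full f.
Proof.
elim: s => // Y s IHs; rewrite inE /dsum big_cons -/(dsum s).
case/predU1P=> [<-|/IHs[f homf fullf]].
  exists (col_mx 1%:M 0) => [g Gg|] /=.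
    by rewrite mul_block_col mul_col_mx !mulmx0 !mul0mx mulmx1 mul1mx !addr0.
  apply/row_fullP; exists (row_mx 1%:M 0).
  by rewrite mul_row_col mulmx1 mulmx0 addr0.
have /row_fullP[f' f'f] := fullf.
exists (col_mx 0 f) => [g Gg|] /=.
  by rewrite mul_block_col mul_col_mx !mulmx0 !mul0mx !add0r homf.
by apply/row_fullP; exists (row_mx 0 f'); rewrite mul_row_col mul0mx add0r.
Qed.

(** A nonzero coefficient forces a summand isomorphic to [X] in the chosen decomposition of [M];
    project onto it. *)
Lemma coeff_green_class_surjection M (X : indec_repr k G) :
  coeff (iso_class X) (green_class M) != 0 ->
  exists2 f : 'M_(rdegree M, rdegree X), kG_hom f & row_full f.
Proof.
rewrite /green_class /indec_summands; case: cid => s /= Ms nz.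
have [Y sY eYX] : exists2 Y, Y \in s & mx_rsim Y X.
  apply: contrapT => nY; case/eqP: nz.
  rewrite raddf_sum big_seq big1 // => Y sY.
  rewrite /= coeffU mul1r; case: eqP => // eXY; case: nY; exists Y => //.
  by move/esym/eqmodP: eXY => /asboolP /mx_rsim_sym.
have [f homf /row_fullP[f' f'f]] := rsim_surjection Ms.
have [g homg /row_fullP[g' g'g]] := dsum_surjection sY.
have [h homh /row_fullP[h' h'h]] := rsim_surjection eYX.
exists (f *m g *m h) => [x Gx|].
  rewrite !mulmxA homf // -!mulmxA; congr (_ *m _).
  by rewrite [LHS]mulmxA homg // -!mulmxA homh.
apply/row_fullP; exists (h' *m g' *m f').
by rewrite -!mulmxA (mulmxA f') f'f mul1mx (mulmxA g') g'g mul1mx.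
Qed.

End Representations.

(** * Stabilizers of simplices and the chain modules *)

Section Complexes.

Variables (gT : finGroupType) (G : {group gT}) (V : finType).
Variable D : G_complex G V.

Lemma min_stab_p_le_group p : (min_stab_p p D <= partn #|G| p)%N.
Proof.
rewrite /min_stab_p; elim/big_rec: _ => // s m _ le_m.
by rewrite geq_min le_m orbT.
Qed.

Lemma min_stab_p_le p s :
  s \in simplices D -> (min_stab_p p D <= partn #|'N_G(s | D)%g| p)%N.
Proof.
move=> Ds; rewrite /min_stab_p; have := mem_index_enum s.
elim: (index_enum _) => // t r IHr; rewrite inE big_cons.
case/predU1P=> [<-|/IHr le_r]; first by rewrite Ds geq_minl.
by case: ifP => // _; rewrite geq_min le_r orbT.
Qed.

Lemma min_stab_p_gt1 p :
    prime p -> (p %| #|G|)%N ->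
    (forall s, s \in simplices D -> (p %| #|'N_G(s | D)%g|)%N) ->
  (1 < min_stab_p p D)%N.
Proof.
move=> pr_p pG pD.
have gt1 (H : {group gT}) : (p %| #|H|)%N -> (1 < partn #|H| p)%N.
  by move=> pH; rewrite p_part_gt1 mem_primes pr_p cardG_gt0.
(* The default [#|G|_p] also enters the minimum; it exceeds 1 because [p] divides [#|G|]. *)
rewrite /min_stab_p; elim/big_ind: _ => [|x y x1 y1|s Ds]; first exact: gt1.
  by rewrite leq_min x1.
exact: gt1 (pD s Ds).
Qed.

Variables (k : fieldType) (n : nat).

(** A stabilizer that fixes every vertex preserves the order of the tuple, so no sign arises. *)
Lemma osimplex_fixed p (t : osimplex D n) :
  exists H : {group gT}, [/\ H \subset G, (min_stab_p p D <= partn #|H| p)%N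
    & forall h, h \in H -> ovec k t *m ochain_mx k D n h = ovec k t].
Proof.
have [H [sHG minH fixH]] : exists H : {group gT},
    [/\ H \subset G, (min_stab_p p D <= partn #|H| p)%N
      & forall h x, h \in H -> x \in val t -> D x h = x].
  have /andP[_ /setU1P[t0|Dt]] := valP t.
    (* The empty tuple, in dimension -1, is fixed by all of [G]; its bound comes from the default
       value of the minimum. *)
    exists G; split=> // [|h x _ tx]; first exact: min_stab_p_le_group.
    by have := in_set0 x; rewrite -t0 inE tx.
  exists 'N_G([set x in val t]%SET | D)%G.
  split=> [||h x Nh tx]; [exact: subsetIl | exact: min_stab_p_le |].
  have /setIP[_ Ch] := subsetP (simplices_stab Dt) h Nh.
  by apply: (astab_act Ch); rewrite inE.
exists H; split=> // h Hh; rewrite (ovec_act k t (subsetP sHG h Hh)).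
congr ovec; apply: val_inj; apply: eq_from_tnth => i /=.
by rewrite tnth_mktuple fixH ?mem_tnth.
Qed.

Lemma chain_module_pim_bound p (S P : representation k G)
    (simS : mx_irreducible S) (covP : projective_cover P S) :
    p \in [pchar k] ->
    pim_mult simS covP (green_class (chain_module k D n)) != 0 ->
  (min_stab_p p D <= rdegree S)%N.
Proof.
move=> charkp /coeff_green_class_surjection[/= b homb /row_fullP[b' b'b]].
have [projP [q [homq /row_fullP[q' q'q] _]]] := covP.
have /mx_irrP[S_gt0 _] := simS.
pose e (t : osimplex D n) := in_factmod (orient_mx k D n) (ovec k t).
(* The classes [e t] span the chain module, and [b *m q] is a surjection onto the nonzero module
   [S]. *)
have [t nz_t] : exists t, e t *m b *m q != 0.
  apply: contrapT => all0.
  have pi0 : in_factmod (orient_mx k D n) 1%:M *m (b *m q) = 0.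
    apply/row_matrixP=> i; rewrite row0 rowE mulmxA -in_factmodE.
    apply/eqP/negbNE/negP=> nz_i; apply: all0; exists (enum_val i).
    by rewrite /e /ovec enum_valK -mulmxA.
  have bq0 : b *m q = 0.
    rewrite -[LHS]mul1mx -(val_factmodK (U := orient_mx k D n) 1%:M).
    by rewrite in_factmodE -mulmxA pi0 mulmx0.
  have /(congr1 mxrank) : 1%:M = 0 :> 'M[k]_(rdegree S).
    by rewrite -q'q -[q]mul1mx -b'b -mulmxA bq0 !mulmx0.
  by rewrite mxrank1 mxrank0 => S0; rewrite S0 in S_gt0.
have [H [sHG minH fixH]] := osimplex_fixed p t.
apply: leq_trans minH _.
have [|y def_y] := @projective_fixed_norm k gT G P H (e t *m b) projP sHG.
  move=> h Hh; have Gh := subsetP sHG h Hh.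
  rewrite -mulmxA -homb // mulmxA; congr (_ *m _).
  rewrite -[RHS]/(in_factmod _ _) -[in RHS](fixH h Hh).
  by rewrite (in_factmodJ (orient_module k D n)).
(* The map [q] commutes with [H], so it carries the norm of [y] to the norm of [y *m q], which is
   the nonzero image of [e t] in [S]. *)
apply: (norm_neq0_partn_leq (rG := S) (w := y *m q) charkp sHG).
move: nz_t; rewrite def_y mulmx_suml; congr (_ != 0).
by apply: eq_bigr => h Hh; rewrite -!mulmxA homq // (subsetP sHG).
Qed.

End Complexes.

Theorem corollary8p2 (R : realType) (k : fieldType) (p : nat)
    (charkp : p \in [pchar k]) (gT : finGroupType) (G : {group gT})
    (V : finType) (D : G_complex G V) (weakD : weak_synthetic_building R p D) :
  (forall (S P : representation k G) (simS : mx_irreducible S)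
          (covP : projective_cover P S),
      ~~ (min_stab_p p D <= rdegree S)%N ->
      pim_mult simS covP (lefschetz_module k D) = 0) /\
  (synthetic_building R p D -> (p %| #|G|)%N ->
    forall (P : representation k G)
           (covP : projective_cover P (trivial_repr k G)),
      pim_mult (trivial_irreducible k G) covP (lefschetz_module k D) = 0).
Proof.
have small (S P : representation k G) (simS : mx_irreducible S)
    (covP : projective_cover P S) :
    ~~ (min_stab_p p D <= rdegree S)%N ->
  pim_mult simS covP (lefschetz_module k D) = 0.
  (* The coefficient is additive, so each chain module can be treated separately. *)
  move=> ltS; rewrite /pim_mult raddf_sum big1 // => n _ /=.
  rewrite coeffZ (_ : coeff _ _ = 0) ?mulr0 //; apply/eqP.
  by apply: contraNT ltS; apply: chain_module_pim_bound charkp.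
split=> // -[_ pD] pG P covP; apply: small.
(* The trivial module has dimension 1, below the minimum. *)
by rewrite -ltnNge min_stab_p_gt1 // (pcharf_prime charkp).
Qed.
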